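(* Let $\mathcal{G}$ be a finite undirected graph on the vertex set $\{1,\dots,n\}$ with edge weights $\gamma_{jk}=\gamma_{kj}>0$, let $\rho$ be the faithful state with density $D_\rho=\sum_{j=1}^n s_jE_{jj}$, and let $\{\Phi_t\}_{t\ge0}$, $\Phi_t=e^{-t\mathcal{L}}$, be the KMS-symmetric quantum Markov semigroup with generator $$\mathcal{L}(X)=\sum_{e_{jk}\in E(\mathcal{G})}\gamma_{jk}\left(\tfrac12\{V_{jk}^*V_{jk},X\}-V_{jk}^*XV_{jk}\right),\qquad V_{jk}=\sqrt{s_j}E_{jk}+\sqrt{s_k}E_{kj}.$$ For an edgeless graph, set $h_{\rho,\mathcal{G}}^2/(2d_{\max})=0$. If $n\ge3$, then $$\min\left\{\frac{h_{\rho,\mathcal{G}}^2}{2d_{\max}},\ \frac{s_-}{2s_+}h_{\rho,\mathcal{G}}\right\}\;\le\;\lambda_{\mathrm{KMS}}\;\le\;2h_{\rho,\mathcal{G}}.$$ If $n=2$ and $\gamma_{12}=\gamma_{21}=\gamma$, then $\lambda_{\mathrm{KMS}}=\frac\gamma2(\sqrt{s_1}-\sqrt{s_2})^2$.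
   Context: $n\ge2$; $M_n(\mathbb{C})$ carries the unnormalized trace $\mathrm{Tr}$; $\{E_{jk}\}$ are the standard matrix units; $\{A,B\}=AB+BA$. The graph is simple (edges join two distinct vertices; $e_{jk}=e_{kj}$ and each edge is counted once in sums over $E(\mathcal{G})$), not assumed connected, and $\gamma_{jk}=0$ if $e_{jk}\notin E(\mathcal{G})$. $s_1,\dots,s_n>0$, $\sum_js_j=1$, $\rho(X)=\mathrm{Tr}(D_\rho X)$; $s_-$ and $s_+$ are the smallest and largest of the $s_j$. KMS inner product: $\langle X,Y\rangle_{\mathrm{KMS},\rho}=\mathrm{Tr}(X^*D_\rho^{1/2}YD_\rho^{1/2})$, with norm $\|X\|_{\mathrm{KMS},\rho}$. Spectral gap (also used when $\ker\mathcal{L}\ne\mathbb{C}I$, in which case it is $0$): $\lambda_{\mathrm{KMS}}=\inf\{\langle X,\mathcal{L}(X)\rangle_{\mathrm{KMS},\rho}/\|X\|_{\mathrm{KMS},\rho}^2:\ 0\ne X\in M_n(\mathbb{C}),\ \rho(X)=0\}$. Weighted degrees: $d_j=\sum_{k:\,e_{jk}\in E(\mathcal{G})}\gamma_{jk}s_k$, $d_{\max}=\max_jd_j$. Graph conductance: $$h_{\rho,\mathcal{G}}=\min_{\emptyset\ne S\subsetneq\{1,\dots,n\}}\frac{\sum_{j\in S,\,k\notin S}\gamma_{jk}s_js_k}{\min\{\sum_{j\in S}s_j,\ \sum_{j\notin S}s_j\}}.$$ *)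

(* Defs.v *)
From HB Require Import structures.
From mathcomp Require Import all_boot all_order all_algebra.
From mathcomp Require Import classical_sets reals.
From mathcomp Require Import complex.

Set Implicit Arguments.
Unset Strict Implicit.
Unset Printing Implicit Defensive.

Import Order.TTheory GRing.Theory Num.Theory.
Local Open Scope ring_scope.
Local Open Scope complex_scope.
Local Open Scope sesquilinear_scope.

(* The complex numbers are [R[i]] over the real numbers [R]; vertices are
   elements of ['I_n]; [A ^t*] is the conjugate transpose of [A]. *)

Definition simple_graph (n : nat) (e : rel 'I_n) : Prop :=
  symmetric e /\ irreflexive e.

Definition edge_weights (R : realType) (n : nat) (e : rel 'I_n)
    (gamma : 'I_n -> 'I_n -> R) : Prop :=
  [/\ forall j k, gamma j k = gamma k j,
      forall j k, e j k -> 0 < gamma j k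
    & forall j k, ~~ e j k -> gamma j k = 0].

Definition faithful_weights (R : realType) (n : nat) (s : 'I_n -> R) : Prop :=
  (forall j, 0 < s j) /\ \sum_(j < n) s j = 1.

(* The default values 1 and 0 are absorbed when [n > 0] and [s] satisfies
   [faithful_weights], since then [0 < s j <= 1]. *)
Definition s_min (R : realType) (n : nat) (s : 'I_n -> R) : R :=
  \big[Num.min/1]_(j < n) s j.

Definition s_max (R : realType) (n : nat) (s : 'I_n -> R) : R :=
  \big[Num.max/0]_(j < n) s j.

Definition density (R : realType) (n : nat) (s : 'I_n -> R) : 'M[R[i]]_n :=
  \sum_(j < n) (s j)%:C *: delta_mx j j.

(* The positive square root of the diagonal matrix [density s]. *)
Definition sqrt_density (R : realType) (n : nat) (s : 'I_n -> R) :
    'M[R[i]]_n :=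
  \sum_(j < n) (Num.sqrt (s j))%:C *: delta_mx j j.

Definition state (R : realType) (n : nat) (s : 'I_n -> R) (X : 'M[R[i]]_n) :
    R[i] :=
  \tr (density s *m X).

Definition kms_dot (R : realType) (n : nat) (s : 'I_n -> R)
    (X Y : 'M[R[i]]_n) : R[i] :=
  \tr (X ^t* *m sqrt_density s *m Y *m sqrt_density s).

Definition kms_norm (R : realType) (n : nat) (s : 'I_n -> R)
    (X : 'M[R[i]]_n) : R[i] :=
  sqrtC (kms_dot s X X).

Definition anticomm (R : realType) (n : nat) (A B : 'M[R[i]]_n) : 'M[R[i]]_n :=
  A *m B + B *m A.

Definition jump (R : realType) (n : nat) (s : 'I_n -> R) (j k : 'I_n) :
    'M[R[i]]_n :=
  (Num.sqrt (s j))%:C *: delta_mx j k + (Num.sqrt (s k))%:C *: delta_mx k j.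

(* Each edge is counted once, through its orientation [j < k]; this choice is
   immaterial because [jump s j k = jump s k j]. *)
Definition generator (R : realType) (n : nat) (e : rel 'I_n)
    (gamma : 'I_n -> 'I_n -> R) (s : 'I_n -> R) (X : 'M[R[i]]_n) :
    'M[R[i]]_n :=
  \sum_(j < n) \sum_(k < n | (j < k)%N && e j k)
    (gamma j k)%:C *:
      (2%:R^-1 *: anticomm ((jump s j k) ^t* *m jump s j k) X
       - (jump s j k) ^t* *m X *m jump s j k).

(* The quotient lies in [R] for the generators above, by KMS-symmetry, so
   [complex.Re] only changes its type; it is also nonnegative, so for [1 < n]
   the infimum is that of a nonempty set that is bounded below. *)
Definition kms_gap (R : realType) (n : nat) (s : 'I_n -> R)
    (L : 'M[R[i]]_n -> 'M[R[i]]_n) : R :=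
  inf [set complex.Re (kms_dot s X (L X) / kms_norm s X ^+ 2)
      | X in [set X : 'M[R[i]]_n | X != 0 /\ state s X = 0]]%classic.

Definition degree (R : realType) (n : nat) (e : rel 'I_n)
    (gamma : 'I_n -> 'I_n -> R) (s : 'I_n -> R) (j : 'I_n) : R :=
  \sum_(k < n | e j k) gamma j k * s k.

(* The degrees are nonnegative, so the default value 0 is absorbed. *)
Definition degree_max (R : realType) (n : nat) (e : rel 'I_n)
    (gamma : 'I_n -> 'I_n -> R) (s : 'I_n -> R) : R :=
  \big[Num.max/0]_(j < n) degree e gamma s j.

Definition cut_ratio (R : realType) (n : nat) (gamma : 'I_n -> 'I_n -> R)
    (s : 'I_n -> R) (S : {set 'I_n}) : R :=
  (\sum_(j in S) \sum_(k in ~: S) gamma j k * s j * s k) /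
  Num.min (\sum_(j in S) s j) (\sum_(j in ~: S) s j).

(* The infimum of a finite set, nonempty for [1 < n], hence a minimum. *)
Definition conductance (R : realType) (n : nat) (gamma : 'I_n -> 'I_n -> R)
    (s : 'I_n -> R) : R :=
  inf [set cut_ratio gamma s S
      | S in [set S : {set 'I_n} |
               S != finset.set0 /\ S \proper [set: 'I_n]%SET]]%classic.

(* The value 0 for an edgeless graph is a convention. *)
Definition cheeger_term (R : realType) (n : nat) (e : rel 'I_n)
    (gamma : 'I_n -> 'I_n -> R) (s : 'I_n -> R) : R :=
  if [exists j, exists k, e j k]
  then conductance gamma s ^+ 2 / (2%:R * degree_max e gamma s)
  else 0.

(* Main.v *)
(** In matrix units the generator decouples: the diagonal of [X] evolves by the
    weighted graph Laplacian, and each pair of entries (a, b), (b, a) spans an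
    invariant block with least eigenvalue
    [(d_a + d_b) / 2 - gamma_ab * sqrt (s_a s_b)].  The gap is thus the minimum
    of the classical gap and of these eigenvalues.  The classical gap is
    controlled by Cheeger's inequality (median, coarea formula, AM-GM); the
    eigenvalue of the block (a, b) is at least half the sum of
    [(gamma_ak + gamma_bk) * s_k] over k outside {a, b}, which for n >= 3 is
    controlled by the conductance of the cut {a, b}. *)
Require Import Defs.
From mathcomp Require Import all_boot all_order all_algebra.
From mathcomp Require Import classical_sets reals.
From mathcomp Require Import complex.
From mathcomp Require Import ring lra.
Import Order.TTheory GRing.Theory Num.Theory.
Local Open Scope ring_scope.

(** * Cheeger's inequality for a weighted finite graph *)

Section Cheeger.
Variables (R : realType) (n : nat).
Implicit Types (f g : 'I_n -> R) (S : {set 'I_n}).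

(** Take for [m] the least value of [f] whose strict upper level set carries at most half the mass.
    The next smaller value fails this test, so the complement of the set below [m] carries more than
    half. *)
Lemma exists_median (s : 'I_n -> R) f :
    (0 < n)%N -> (forall a, 0 < s a) ->
  exists m, 2%:R * \sum_(a | m < f a) s a <= \sum_a s a /\
            2%:R * \sum_(a | f a < m) s a <= \sum_a s a.
Proof.
move=> n_gt0 s_gt0.
pose P i := 2%:R * \sum_(a | f i < f a) s a <= \sum_a s a.
have tot_ge0 : 0 <= \sum_a s a by apply: sumr_ge0 => a _; apply: ltW.
have [imax _ imaxP] : exists2 i, true & forall j, f j <= f i.
  by case: (@arg_maxP _ _ _ (Ordinal n_gt0) predT f) => // i _ iP;
    exists i => // j; apply: iP.
have Pmax : P imax.
  by rewrite /P big_pred0 ?mulr0 // => a; apply/negbTE; rewrite -leNgt.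
case: (@arg_minP _ _ _ imax P f) => // i Pi iP; exists (f i); split=> //.
have [/existsP[j0 j0P]|/existsPn none] :=
  boolP [exists j, f j < f i]; last first.
  by rewrite big_pred0 ?mulr0 // => a; apply/negbTE/none.
case: (@arg_maxP _ _ _ j0 (fun j => f j < f i) f) => // j ji jP.
have : ~~ P j by apply/negP => /iP; rewrite leNgt ji.
rewrite /P -ltNge => hj.
rewrite (bigID (fun a => f j < f a)) /= in hj *.
(* As [f j] is the largest value below [f i], lying below [f i] means not exceeding [f j]. *)
have -> : \sum_(a | f a < f i) s a = \sum_(a | ~~ (f j < f a)) s a.
  apply: eq_bigl => a; rewrite -leNgt; apply/idP/idP => [/jP //|/le_lt_trans].
  exact.
lra.
Qed.

(** Only pairs that cross the cut contribute, and the sum over ordered pairs meets each of them once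
    from either side; hence the factor 2. *)
Lemma cut_indicator (w : 'I_n -> 'I_n -> R) S :
    (forall a b, w a b = w b a) ->
  \sum_a \sum_b w a b * `|(a \in S)%:R - (b \in S)%:R|
    = 2%:R * \sum_(a in S) \sum_(b in ~: S) w a b.
Proof.
move=> wC; have cut_sym : \sum_(a in S) \sum_(b in ~: S) w a b
             = \sum_(a in ~: S) \sum_(b in S) w a b.
  by rewrite exchange_big /=; apply: eq_bigr => a _; apply: eq_bigr.
rewrite mulr_natl mulr2n {2}cut_sym (bigID (mem S)) /=; congr (_ + _).
  apply: eq_bigr => a aS; rewrite aS (bigID (mem S)) /= big1 ?add0r.
    by apply: eq_big => [b|b /negbTE ->]; rewrite ?inE // subr0 normr1 mulr1.
  by move=> b ->; rewrite subrr normr0 mulr0.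
rewrite (eq_bigl (fun a => a \in ~: S)) => [|a]; last by rewrite inE.
apply: eq_bigr => a; rewrite inE => /negbTE ->.
rewrite (bigID (mem S)) /= [X in _ + X]big1 ?addr0.
  by apply: eq_bigr => b ->; rewrite sub0r normrN normr1 mulr1.
by move=> b /negbTE ->; rewrite subrr normr0 mulr0.
Qed.

(* Induction on the support of [g], peeling off the layer below the least
   positive value of [g]. *)
Lemma coarea (s : 'I_n -> R) (w : 'I_n -> 'I_n -> R) (h : R) :
    (forall a b, w a b = w b a) ->
    (forall S, S != finset.set0 -> 2%:R * \sum_(a in S) s a <= \sum_a s a ->
       h * \sum_(a in S) s a <= \sum_(a in S) \sum_(b in ~: S) w a b) ->
    (forall a, 0 < s a) ->
  forall g, (forall a, 0 <= g a) ->
    2%:R * \sum_(a | 0 < g a) s a <= \sum_a s a ->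
  2%:R * h * \sum_a s a * g a <= \sum_a \sum_b w a b * `|g a - g b|.
Proof.
move=> wC cutP s_gt0 g.
have [N] := ubnP #|[set a | 0 < g a]|.
elim: N g => // N IH g; rewrite ltnS => leN g_ge0 half.
set S := [set a | 0 < g a] in leN.
have memS a : (a \in S) = (0 < g a) by rewrite /S inE.
clearbody S.
have [S0|Sn0] := eqVneq S finset.set0.
  have g0 a : g a = 0.
    apply/eqP; rewrite eq_le g_ge0 andbT leNgt; apply/negP => ga.
    by move: (finset.in_set0 a); rewrite -S0 memS ga.
  rewrite [X in _ * X]big1 => [|a _]; last by rewrite g0 mulr0.
  rewrite big1 ?mulr0 // => a _.
  by rewrite big1 // => b _; rewrite !g0 subrr normr0 mulr0.
have /set0Pn [a0 a0S] := Sn0.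
case: (@arg_minP _ _ _ a0 (mem S) g) => // i /= iS' iP.
have iS : i \in S := iS'.
pose m := g i; have m_gt0 : 0 < m by rewrite -memS.
(* The function [g'] is [g] lowered by [m] on its support. It vanishes at the minimiser [i], so its
   support is strictly smaller. *)
pose g' a := if a \in S then g a - m else 0.
have gE a : g a = m * (a \in S)%:R + g' a.
  rewrite /g'; case: ifPn => [_|]; first by rewrite mulr1 addrC subrK.
  rewrite memS -leNgt => ga; rewrite mulr0 addr0; apply/le_anti.
  by rewrite ga g_ge0.
have g'_ge0 a : 0 <= g' a.
  by rewrite /g'; case: ifPn => // aS; rewrite subr_ge0; apply: iP.
have subS a : 0 < g' a -> a \in S.
  by rewrite /g'; case: ifPn => // _; rewrite ltxx.
have halfS : 2%:R * \sum_(a in S) s a <= \sum_a s a.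
  by rewrite (eq_bigl (fun a => 0 < g a)) // => a; rewrite memS.
have /IH : (#|[set a | (0 < g' a)%R]| < N)%N.
  apply: leq_trans leN; apply: proper_card; apply/properP; split.
    by apply/fintype.subsetP => a; rewrite inE; apply: subS.
  by exists i => //; rewrite inE /g' iS subrr ltxx.
move=> /(_ g'_ge0); have half' : 2%:R * \sum_(a | 0 < g' a) s a <= \sum_a s a.
  apply: le_trans halfS; rewrite ler_pM2l ?ltr0n //.
  rewrite [leRHS](bigID (fun a => 0 < g' a)) /= -[leLHS]addr0; apply: lerD.
    rewrite le_eqVlt; apply/orP; left; apply/eqP; apply: eq_bigl => a.
    by apply/idP/andP => [h'|[]] //; split=> //; apply: subS.
  by apply: sumr_ge0 => a _; apply: ltW.
move=> /(_ half') IHg'.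
have cutS := cutP S Sn0 halfS.
have indE := cut_indicator w S wC.
(* Absolute differences add up because the indicator of [S] and [g'] are comonotone: [g'] is
   nonnegative and vanishes outside [S]. *)
have -> : \sum_a \sum_b w a b * `|g a - g b|
   = m * (\sum_a \sum_b w a b * `|(a \in S)%:R - (b \in S)%:R : R|)
     + \sum_a \sum_b w a b * `|g' a - g' b|.
  rewrite mulr_sumr -big_split; apply: eq_bigr => a _ /=.
  rewrite mulr_sumr -big_split; apply: eq_bigr => b _ /=.
  rewrite mulrCA -mulrDr; congr (_ * _).
  rewrite 2!gE; have := g'_ge0 a; have := g'_ge0 b.
  rewrite /g'; case: (a \in S); case: (b \in S) => h1 h2.
  - by rewrite subrr normr0 mulr0 add0r; congr `|_|; ring.
  - rewrite addr0 mulr0 mulr1 !subr0 normr1 mulr1 (ger0_norm h2) ger0_norm //.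
    by rewrite addr_ge0 // ltW.
  - rewrite sub0r normrN normr1 addr0 mulr0 !mulr1 !sub0r !normrN.
    rewrite (ger0_norm h1) ger0_norm //.
    by rewrite addr_ge0 // ltW.
  - by rewrite !subrr normr0 !mulr0 addr0.
have -> : \sum_a s a * g a = m * (\sum_(a in S) s a) + \sum_a s a * g' a.
  rewrite mulr_sumr [X in _ = X + _]big_mkcond -big_split.
  apply: eq_bigr => a _ /=; rewrite gE mulrDr; congr (_ + _).
  by case: (a \in S); rewrite ?mulr1 ?mulr0 // mulrC.
rewrite indE; move/(ler_wpM2l (ltW m_gt0)): cutS; lra.
Qed.

(* To be applied to the positive and negative parts of [f - m], [m] a median. *)
Lemma half_cheeger (s : 'I_n -> R) (w : 'I_n -> 'I_n -> R) (h D : R) :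
    (forall a b, w a b = w b a) -> (forall a b, 0 <= w a b) ->
    (forall S, S != finset.set0 -> 2%:R * \sum_(a in S) s a <= \sum_a s a ->
       h * \sum_(a in S) s a <= \sum_(a in S) \sum_(b in ~: S) w a b) ->
    (forall a, 0 < s a) -> 0 < D -> 0 <= h ->
    (forall a, \sum_b w a b <= D * s a) ->
  forall g, (forall a, 0 <= g a) ->
    2%:R * \sum_(a | 0 < g a) s a <= \sum_a s a ->
  h ^+ 2 * \sum_a s a * g a ^+ 2
    <= D * \sum_a \sum_b w a b * (g a - g b) ^+ 2.
Proof.
move=> wC w_ge0 cutP s_gt0 D_gt0 h_ge0 degD g g_ge0 half.
(* The coarea bound is applied to the square of [g], which has the same support; [|x^2 - y^2|] then
   factors as [|x - y| |x + y|]. *)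
have half2 : 2%:R * \sum_(a | 0 < g a ^+ 2) s a <= \sum_a s a.
  rewrite (eq_bigl (fun a => 0 < g a)) // => a.
  by rewrite !lt0r sqrf_eq0 sqr_ge0 g_ge0.
have := @coarea s w h wC cutP s_gt0 (fun a => g a ^+ 2)
  (fun a => sqr_ge0 _) half2.
set N := \sum_a s a * _; set E := \sum_a \sum_b _ * _ ^+ 2.
set C := \sum_a \sum_b _ * `|_| => coP.
(* Here [(x + y)^2 <= 2 (x^2 + y^2)], and the degree bound controls each of the two resulting sums
   by [D * N]. *)
have degN : \sum_a \sum_b w a b * (g a + g b) ^+ 2 <= 4%:R * D * N.
  have le1 : \sum_a \sum_b w a b * g a ^+ 2 <= D * N.
    rewrite mulr_sumr; apply: ler_sum => a _.
    by rewrite -mulr_suml [leRHS]mulrA; apply: ler_wpM2r => //; apply: sqr_ge0.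
  have le2 : \sum_a \sum_b w a b * g b ^+ 2 <= D * N.
    rewrite exchange_big; apply: le_trans le1; rewrite le_eqVlt; apply/orP.
    left; apply/eqP; apply: eq_bigr => a _; apply: eq_bigr => b _.
    by rewrite wC.
  have : \sum_a \sum_b w a b * (g a + g b) ^+ 2
     <= 2%:R * (\sum_a \sum_b w a b * g a ^+ 2 +
               \sum_a \sum_b w a b * g b ^+ 2).
    rewrite -big_split mulr_sumr; apply: ler_sum => a _ /=.
    rewrite -big_split mulr_sumr; apply: ler_sum => b _ /=.
    by have := mulr_ge0 (w_ge0 a b) (sqr_ge0 (g a - g b)); lra.
  lra.
(* AM-GM in place of Cauchy-Schwarz: [4 D h |xy| <= 4 D^2 x^2 + h^2 y^2]
   with [x = g a - g b] and [y = g a + g b]. *)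
have amgm : 4%:R * D * h * C <= 4%:R * D ^+ 2 * E
     + h ^+ 2 * \sum_a \sum_b w a b * (g a + g b) ^+ 2.
  rewrite !mulr_sumr -big_split; apply: ler_sum => a _ /=.
  rewrite !mulr_sumr -big_split; apply: ler_sum => b _ /=.
  rewrite subr_sqr normrM (mulrCA _ (w a b)) [X in _ <= X + _]mulrCA.
  rewrite [X in _ <= _ + X]mulrCA -mulrDr; apply: ler_wpM2l => //.
  have := sqr_ge0 (2%:R * D * `|g a - g b| - h * `|g a + g b|).
  rewrite sqrrB !exprMn !real_normK ?num_real //.
  lra.
(* Scaling [coP] by [4 D h] and chaining with [amgm] and [degN] gives
   [8 D h^2 N <= 4 D^2 E + 4 D h^2 N], which is the claim multiplied by [4 D]. *)
have Dh : 0 <= 4%:R * D * h by rewrite !mulr_ge0 // ltW.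
have := ler_wpM2l Dh coP; have := ler_wpM2l (sqr_ge0 h) degN.
move=> le3 le4; have {}le4 := le_trans le4 amgm.
rewrite -(ler_pM2l (_ : 0 < 4%:R * D)) ?mulr_gt0 //.
lra.
Qed.

(** Both parts of [f - m], with [m] a median, live on at most half the mass, so [half_cheeger]
    applies to each. Subtracting [m] from a mean-zero [f] does not decrease the norm, and splitting
    into parts does not increase the energy. *)
Lemma cheeger_inequality (s : 'I_n -> R) (w : 'I_n -> 'I_n -> R) (h D : R) :
    (forall a b, w a b = w b a) -> (forall a b, 0 <= w a b) ->
    (forall S, S != finset.set0 -> 2%:R * \sum_(a in S) s a <= \sum_a s a ->
       h * \sum_(a in S) s a <= \sum_(a in S) \sum_(b in ~: S) w a b) ->
    (forall a, 0 < s a) -> 0 < D -> 0 <= h ->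
    (forall a, \sum_b w a b <= D * s a) ->
  forall f, \sum_a s a * f a = 0 ->
  h ^+ 2 * \sum_a s a * f a ^+ 2
    <= D * \sum_a \sum_b w a b * (f a - f b) ^+ 2.
Proof.
move=> wC w_ge0 cutP s_gt0 D_gt0 h_ge0 degD f f0.
have [n0|n_gt0] := posnP n.
  by rewrite !big1 ?mulr0 // => -[i i_lt]; exfalso; rewrite n0 in i_lt.
have [m [up down]] := exists_median s f n_gt0 s_gt0.
pose p a := Num.max (f a - m) 0; pose q a := Num.max (m - f a) 0.
have p_ge0 a : 0 <= p a by rewrite le_max lexx orbT.
have q_ge0 a : 0 <= q a by rewrite le_max lexx orbT.
have half_p : 2%:R * \sum_(a | 0 < p a) s a <= \sum_a s a.
  by rewrite (eq_bigl (fun a => m < f a)) // => a;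
    rewrite lt_max ltxx orbF subr_gt0.
have half_q : 2%:R * \sum_(a | 0 < q a) s a <= \sum_a s a.
  by rewrite (eq_bigl (fun a => f a < m)) // => a;
    rewrite lt_max ltxx orbF subr_gt0.
have chp :=
  half_cheeger s w h D wC w_ge0 cutP s_gt0 D_gt0 h_ge0 degD p p_ge0 half_p.
have chq :=
  half_cheeger s w h D wC w_ge0 cutP s_gt0 D_gt0 h_ge0 degD q q_ge0 half_q.
have fE a : f a = m + p a - q a /\ p a * q a = 0.
  rewrite /p /q; have [fm|fm] := leP (f a) m.
    rewrite max_r ?subr_le0 // max_l ?subr_ge0 // mul0r; split=> //; ring.
  rewrite max_l ?subr_ge0 ?(ltW fm) // max_r ?subr_le0 ?(ltW fm) //.
  by rewrite mulr0; split=> //; ring.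
(* Since [p * q = 0], the right-hand side is the squared norm of [f - m]; its cross term vanishes
   because [f] has mean zero. *)
have normE : \sum_a s a * f a ^+ 2
     <= \sum_a s a * p a ^+ 2 + \sum_a s a * q a ^+ 2.
  have -> : \sum_a s a * p a ^+ 2 + \sum_a s a * q a ^+ 2
      = \sum_a s a * f a ^+ 2 - 2%:R * m * (\sum_a s a * f a)
        + m ^+ 2 * \sum_a s a.
    rewrite !mulr_sumr -sumrB -!big_split; apply: eq_bigr => a _ /=.
    have [-> pq] := fE a.
    have -> : s a * p a ^+ 2 + s a * q a ^+ 2
      = s a * ((p a - q a) ^+ 2) + 2%:R * s a * (p a * q a) by ring.
    rewrite pq; ring.
  rewrite f0 mulr0 subr0 lerDl mulr_ge0 ?sqr_ge0 // sumr_ge0 // => a _.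
  exact: ltW.
(* The cross term is [- 2 (p a - p b) (q a - q b) = 2 (p a * q b + p b * q a)], which is
   nonnegative. *)
have energyE : \sum_a \sum_b w a b * (p a - p b) ^+ 2
      + \sum_a \sum_b w a b * (q a - q b) ^+ 2
    <= \sum_a \sum_b w a b * (f a - f b) ^+ 2.
  rewrite -big_split; apply: ler_sum => a _ /=.
  rewrite -big_split; apply: ler_sum => b _ /=.
  rewrite -mulrDr; apply: ler_wpM2l => //.
  have [-> pqa] := fE a; have [-> pqb] := fE b.
  have := mulr_ge0 (p_ge0 a) (q_ge0 b); have := mulr_ge0 (p_ge0 b) (q_ge0 a).
  lra.
have := ler_wpM2l (ltW D_gt0) energyE.
have := ler_wpM2l (sqr_ge0 h) normE.
lra.
Qed.

End Cheeger.

(** * Edge sums and calculus with matrix units *)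

Lemma sum_edges (V : zmodType) (n : nat) (e : rel 'I_n)
    (F : 'I_n -> 'I_n -> V) :
    symmetric e -> irreflexive e -> (forall j k, ~~ e j k -> F j k = 0) ->
  \sum_(j < n) \sum_(k < n | (j < k)%N && e j k) (F j k + F k j)
    = \sum_j \sum_k F j k.
Proof.
move=> eC eI F0.
under eq_bigr do rewrite big_split.
rewrite big_split /=.
(* Renaming the indices turns the reversed terms into the orientation [k < j]. The two orientations
   exhaust the edges, irreflexivity excluding the diagonal. *)
have -> : \sum_(j < n) \sum_(k < n | (j < k)%N && e j k) F k j
        = \sum_(j < n) \sum_(k < n | (k < j)%N && e j k) F j k.
  under eq_bigr do rewrite big_mkcond.
  rewrite exchange_big; apply: eq_bigr => j _ /=.
  by rewrite [RHS]big_mkcond; apply: eq_bigr => k _; rewrite eC.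
rewrite -big_split; apply: eq_bigr => j _ /=.
rewrite [RHS](bigID (e j)) /= [X in _ = _ + X]big1 ?addr0 => [|k];
  last exact: F0.
rewrite [RHS](bigID (fun k : 'I_n => (j < k)%N)) /=.
congr (_ + _); apply: eq_bigl => k; rewrite andbC //.
case: ltngtP => // jk; rewrite ?andbF //.
by rewrite (ord_inj jk) eI.
Qed.

Lemma delta_mulmx (K : pzSemiRingType) (m n p : nat) (i : 'I_m) (j : 'I_n)
    (X : 'M[K]_(n, p)) a b :
  (delta_mx i j *m X) a b = (a == i)%:R * X j b.
Proof.
rewrite mxE (bigD1 j) //= big1 ?addr0 => [|k /negbTE kj].
  by rewrite mxE eqxx andbT.
by rewrite mxE kj andbF mul0r.
Qed.

Lemma mulmx_delta (K : pzSemiRingType) (m n p : nat) (i : 'I_n) (j : 'I_p)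
    (X : 'M[K]_(m, n)) a b :
  (X *m delta_mx i j) a b = X a i * (b == j)%:R.
Proof.
rewrite mxE (bigD1 i) //= big1 ?addr0 => [|k /negbTE ki].
  by rewrite mxE eqxx.
by rewrite mxE ki mulr0.
Qed.

Lemma addmxE (K : pzRingType) (m n : nat) (A B : 'M[K]_(m, n)) a b :
  (A + B) a b = A a b + B a b.
Proof. by rewrite mxE. Qed.

Lemma oppmxE (K : pzRingType) (m n : nat) (A : 'M[K]_(m, n)) a b :
  (- A) a b = - A a b.
Proof. by rewrite mxE. Qed.

Lemma scalemxE (K : pzRingType) (m n : nat) (c : K) (A : 'M[K]_(m, n)) a b :
  (c *: A) a b = c * A a b.
Proof. by rewrite mxE. Qed.

Lemma two_unit_sandwich (K : comNzRingType) (n : nat) (c d : K) (j k : 'I_n)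
    (X : 'M[K]_n) a b :
  ((c *: delta_mx k j + d *: delta_mx j k) *m X
     *m (c *: delta_mx j k + d *: delta_mx k j)) a b =
    c ^+ 2 * X j j * (a == k)%:R * (b == k)%:R
  + d ^+ 2 * X k k * (a == j)%:R * (b == j)%:R
  + c * d * (X j k * (a == k)%:R * (b == j)%:R
           + X k j * (a == j)%:R * (b == k)%:R).
Proof.
rewrite !(mulmxDl, mulmxDr) -!(scalemxAl, scalemxAr) !scalerA.
by rewrite !(addmxE, scalemxE) !mulmx_delta !delta_mulmx; ring.
Qed.

Lemma two_unit_square (K : comNzRingType) (n : nat) (c d : K) (j k : 'I_n) :
    j != k ->
  (c *: delta_mx k j + d *: delta_mx j k)
     *m (c *: delta_mx j k + d *: delta_mx k j) =
  c ^+ 2 *: delta_mx k k + d ^+ 2 *: delta_mx j j.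
Proof.
move=> jk; rewrite !(mulmxDl, mulmxDr) -!(scalemxAl, scalemxAr).
rewrite !mul_delta_mx_cond !eqxx (negbTE jk) eq_sym (negbTE jk).
by rewrite !mulr1n !mulr0n !scaler0 addr0 add0r !scalerA.
Qed.

(** An edge term is the sum of two mirror images, exchanged by swapping [c] with [d] and [j] with
    [k]. This is the shape [F j k + F k j] that [sum_edges] turns into a sum over ordered pairs. *)
Lemma two_unit_lindblad (K : comNzRingType) (n : nat) (g h c d : K)
    (j k : 'I_n) (X : 'M[K]_n) a b :
    j != k ->
  let V := c *: delta_mx j k + d *: delta_mx k j in
  let W := c *: delta_mx k j + d *: delta_mx j k in
  let F c d j k := g *
    (h * d ^+ 2 * ((a == j)%:R + (b == j)%:R) * X a b
     - d ^+ 2 * X k k * (a == j)%:R * (b == j)%:R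
     - c * d * X k j * (a == j)%:R * (b == k)%:R) in
  (g *: (h *: (W *m V *m X + X *m (W *m V)) - W *m X *m V)) a b
    = F c d j k + F d c k j.
Proof.
move=> jk V W F.
rewrite !(addmxE, oppmxE, scalemxE) two_unit_sandwich two_unit_square //.
rewrite mulmxDl mulmxDr -!(scalemxAl, scalemxAr).
rewrite !(addmxE, scalemxE) !mulmx_delta !delta_mulmx /F.
(* A Kronecker symbol allows the index that it fixes to be replaced, so every entry from the
   anticommutator becomes [X a b]. *)
have -> : (a == k)%:R * X k b = (a == k)%:R * X a b.
  by case: eqP => [->|] //; rewrite !mul0r.
have -> : (a == j)%:R * X j b = (a == j)%:R * X a b.
  by case: eqP => [->|] //; rewrite !mul0r.
have -> : X a k * (b == k)%:R = (b == k)%:R * X a b.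
  by case: eqP => [->|]; rewrite mulrC //; rewrite !mul0r.
have -> : X a j * (b == j)%:R = (b == j)%:R * X a b.
  by case: eqP => [->|]; rewrite mulrC //; rewrite !mul0r.
ring.
Qed.

(** * The generator in matrix units *)

Section Generator.
Local Open Scope complex_scope.
Local Open Scope sesquilinear_scope.
Variables (R : realType) (n : nat).
Variables (e : rel 'I_n) (gamma : 'I_n -> 'I_n -> R) (s : 'I_n -> R).
Hypothesis graph_e : simple_graph e.
Hypothesis weights_gamma : edge_weights e gamma.
Hypothesis weights_s : faithful_weights s.

Let r (j : 'I_n) : R := Num.sqrt (s j).

Lemma jump_adjoint j k :
  (jump s j k) ^t* = (r j)%:C *: delta_mx k j + (r k)%:C *: delta_mx j k.
Proof.
rewrite /jump linearD !linearZ /= !trmx_delta map_mxD !map_mxZ !map_delta_mx.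
by congr (_ *: _ + _ *: _); exact: conjc_real.
Qed.

Let nonedge j k : ~~ e j k -> gamma j k = 0.
Proof. by case: weights_gamma => _ _; apply. Qed.

Let gammaC j k : gamma j k = gamma k j.
Proof. by case: weights_gamma. Qed.

Lemma degreeE j : degree e gamma s j = \sum_k gamma j k * s k.
Proof.
rewrite /degree [RHS](bigID (e j)) /= [X in _ = _ + X]big1 ?addr0 // => k jk.
by rewrite nonedge // mul0r.
Qed.

(** This is the decoupling: off the diagonal only [X a b] and [X b a] occur, while on the diagonal
    only diagonal entries do, the last term vanishing because there are no loops. *)
Lemma generatorE X a b : generator e gamma s X a b =
    ((degree e gamma s a + degree e gamma s b) / 2%:R)%:C * X a b
  - (a == b)%:R * (\sum_k (gamma a k * s k)%:C * X k k)
  - (gamma a b * (r a * r b))%:C * X b a.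
Proof.
case: (graph_e) => eC eI.
have sqr i : r i ^+ 2 = s i by rewrite sqr_sqrtr // ltW //; case: weights_s.
have sqrC i : (r i)%:C ^+ 2 = (s i)%:C :> R[i] by rewrite -rmorphXn sqr.
pose F j k : R[i] := (gamma j k)%:C *
  (2%:R^-1 * (s k)%:C * ((a == j)%:R + (b == j)%:R) * X a b
   - (s k)%:C * X k k * (a == j)%:R * (b == j)%:R
   - (r j)%:C * (r k)%:C * X k j * (a == j)%:R * (b == k)%:R).
(* [F j k] is the half of an edge term that belongs to the orientation from [j] to [k]; it vanishes
   off the edges, so the sum may run over all ordered pairs. *)
transitivity (\sum_j \sum_k F j k).
  rewrite -(sum_edges _ _ e) // => [|j k jk]; last first.
    by rewrite /F nonedge // mul0r.
  rewrite /generator summxE; apply: eq_bigr => j _.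
  rewrite summxE; apply: eq_bigr => k /andP[jk _].
  have njk : j != k by rewrite neq_ltn jk.
  rewrite /anticomm jump_adjoint {1}/jump two_unit_lindblad //.
  by rewrite /F (gammaC k j) !sqrC.
have sum1 c (G : 'I_n -> R[i]) : \sum_j (c == j)%:R * G j = G c.
  rewrite (bigD1 c) //= eqxx mul1r big1 ?addr0 // => j /negbTE jc.
  by rewrite eq_sym jc mul0r.
pose d j : R[i] := \sum_k (gamma j k * s k)%:C.
have dE j : (degree e gamma s j)%:C = d j by rewrite degreeE rmorph_sum.
(* Terms are grouped by their Kronecker symbols so that [sum1] can collapse the sums. *)
transitivity (\sum_j ((a == j)%:R * (2%:R^-1 * X a b * d j)
    + (b == j)%:R * (2%:R^-1 * X a b * d j)
    - (a == j)%:R * ((b == j)%:R * \sum_k (gamma j k * s k)%:C * X k k)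
    - (a == j)%:R *
       \sum_k (b == k)%:R * ((gamma j k * (r j * r k))%:C * X k j))).
  apply: eq_bigr => j _; rewrite /d !mulr_sumr -!big_split -!sumrB.
  by apply: eq_bigr => k _; rewrite /F !rmorphM /=; ring.
rewrite !(sumrB, big_split) /= !sum1 !rmorphM fmorphV rmorph_nat rmorphD /= !dE.
rewrite (eq_sym b a); ring.
Qed.

End Generator.

(** * Reduction to real quadratic forms *)

Definition kms_form {R : realType} {n : nat} (s : 'I_n -> R)
    (u v : 'I_n -> 'I_n -> R) : R :=
  \sum_a \sum_b Num.sqrt (s a) * Num.sqrt (s b) * (u a b * v a b).

(** The coefficients in [generatorE] are real, so the generator acts separately on the real and the
    imaginary parts of the entries; this is its action on one such real array. *)
Definition generator_coef {R : realType} {n : nat} (e : rel 'I_n)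
    (gamma : 'I_n -> 'I_n -> R) (s : 'I_n -> R) (u : 'I_n -> 'I_n -> R)
    (a b : 'I_n) : R :=
  (degree e gamma s a + degree e gamma s b) / 2%:R * u a b
  - (a == b)%:R * (\sum_k gamma a k * s k * u k k)
  - gamma a b * (Num.sqrt (s a) * Num.sqrt (s b)) * u b a.

Section RealForm.
Local Open Scope complex_scope.
Local Open Scope sesquilinear_scope.
Variables (R : realType).

Lemma Re_sum (I : finType) (F : I -> R[i]) :
  complex.Re (\sum_i F i) = \sum_i complex.Re (F i).
Proof. by apply: (big_morph (@complex.Re R)) => // -[? ?] [? ?]. Qed.

Lemma Im_sum (I : finType) (F : I -> R[i]) :
  complex.Im (\sum_i F i) = \sum_i complex.Im (F i).
Proof. by apply: (big_morph (@complex.Im R)) => // -[? ?] [? ?]. Qed.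

Lemma Re_scale (c : R) (x : R[i]) : complex.Re (c%:C * x) = c * complex.Re x.
Proof. by case: x => u v /=; rewrite mul0r subr0. Qed.

Lemma Im_scale (c : R) (x : R[i]) : complex.Im (c%:C * x) = c * complex.Im x.
Proof. by case: x => u v /=; rewrite mul0r addr0. Qed.

Lemma ReB (x y : R[i]) : complex.Re (x - y) = complex.Re x - complex.Re y.
Proof. by case: x y => [? ?] []. Qed.

Lemma ImB (x y : R[i]) : complex.Im (x - y) = complex.Im x - complex.Im y.
Proof. by case: x y => [? ?] []. Qed.

Variables (n : nat) (e : rel 'I_n) (gamma : 'I_n -> 'I_n -> R) (s : 'I_n -> R).

Lemma sqrt_densityE :
  sqrt_density s = diag_mx (\row_j (Num.sqrt (s j))%:C) :> 'M[R[i]]_n.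
Proof.
by rewrite diag_mx_sum_delta; apply: eq_bigr => j _; rewrite [in RHS]mxE.
Qed.

Lemma densityE : density s = diag_mx (\row_j (s j)%:C) :> 'M[R[i]]_n.
Proof.
by rewrite diag_mx_sum_delta; apply: eq_bigr => j _; rewrite [in RHS]mxE.
Qed.

Lemma stateE X : state s X = \sum_j (s j)%:C * X j j.
Proof.
rewrite /state densityE mul_diag_mx; apply: eq_bigr => j _.
by rewrite mxE [X in X * _]mxE.
Qed.

Lemma kms_dotE X Y : kms_dot s X Y =
  \sum_a \sum_b (Num.sqrt (s a) * Num.sqrt (s b))%:C * ((X a b)^* * Y a b).
Proof.
rewrite /kms_dot sqrt_densityE exchange_big; apply: eq_bigr => j _ /=.
have rowE k : (\row_j (Num.sqrt (s j))%:C : 'rV[R[i]]_n) 0 k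
    = (Num.sqrt (s k))%:C by rewrite mxE.
have adjE k : (X ^t*) j k = (X k j)^* by rewrite mxE mxE.
rewrite mul_mx_diag mxE rowE mxE mulr_suml; apply: eq_bigr => k _.
by rewrite mul_mx_diag mxE rowE adjE rmorphM /=; ring.
Qed.

Lemma Re_kms_dot X Y : complex.Re (kms_dot s X Y) =
  kms_form s (fun a b => complex.Re (X a b)) (fun a b => complex.Re (Y a b)) +
  kms_form s (fun a b => complex.Im (X a b)) (fun a b => complex.Im (Y a b)).
Proof.
rewrite kms_dotE Re_sum /kms_form -big_split; apply: eq_bigr => a _ /=.
rewrite Re_sum -big_split; apply: eq_bigr => b _ /=.
rewrite Re_scale -mulrDr; congr (_ * _).
by case: (X a b) (Y a b) => [x x'] [y y'] /=; rewrite mulNr opprK.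
Qed.

Lemma Im_kms_dotxx X : complex.Im (kms_dot s X X) = 0.
Proof.
rewrite kms_dotE Im_sum big1 // => a _; rewrite Im_sum big1 // => b _.
rewrite Im_scale; case: (X a b) => [x x'] /=; ring.
Qed.

Hypothesis graph_e : simple_graph e.
Hypothesis weights_gamma : edge_weights e gamma.
Hypothesis weights_s : faithful_weights s.

Lemma Re_generator X a b : complex.Re (generator e gamma s X a b) =
  generator_coef e gamma s (fun a b => complex.Re (X a b)) a b.
Proof.
rewrite generatorE // !ReB !Re_scale /generator_coef.
congr (_ - _ - _); case: (a == b); rewrite ?mul0r // !mul1r Re_sum.
by apply: eq_bigr => k _; rewrite Re_scale.
Qed.

Lemma Im_generator X a b : complex.Im (generator e gamma s X a b) =
  generator_coef e gamma s (fun a b => complex.Im (X a b)) a b.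
Proof.
rewrite generatorE // !ImB !Im_scale /generator_coef.
congr (_ - _ - _); case: (a == b); rewrite ?mul0r // !mul1r Im_sum.
by apply: eq_bigr => k _; rewrite Im_scale.
Qed.

Definition dirichlet_form (u : 'I_n -> 'I_n -> R) : R :=
  kms_form s u (generator_coef e gamma s u).

(** Real coefficients keep the real and imaginary parts of [X] apart in numerator and denominator
    alike. The squared norm has zero imaginary part, so dividing by it is a real scaling. *)
Lemma rayleighE (X : 'M[R[i]]_n) :
  let u a b := complex.Re (X a b) in let v a b := complex.Im (X a b) in
  complex.Re (kms_dot s X (generator e gamma s X) / kms_norm s X ^+ 2) =
  (dirichlet_form u + dirichlet_form v) / (kms_form s u u + kms_form s v v).
Proof.
move=> u v; rewrite /kms_norm sqrtCK.
have -> : kms_dot s X X = (kms_form s u u + kms_form s v v)%:C.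
  apply/eqP; rewrite eq_complex Re_kms_dot Im_kms_dotxx /=.
  by rewrite !eqxx.
rewrite -fmorphV mulrC Re_scale mulrC Re_kms_dot; congr ((_ + _) * _).
  by apply: eq_bigr => a _; apply: eq_bigr => b _; rewrite Re_generator.
by apply: eq_bigr => a _; apply: eq_bigr => b _; rewrite Im_generator.
Qed.

Let gammaC j k : gamma j k = gamma k j.
Proof. by case: weights_gamma. Qed.

Lemma weight_ge0 j k : 0 <= gamma j k.
Proof.
case: weights_gamma => _ gt0 eq0; have [/gt0/ltW|/eq0 ->] // := boolP (e j k).
Qed.

Lemma weight_diag j : gamma j j = 0.
Proof. by case: weights_gamma => _ _; apply; case: graph_e => _ ->. Qed.

Let s_gt0 j : 0 < s j. Proof. by case: weights_s. Qed.

Let sqr j : Num.sqrt (s j) * Num.sqrt (s j) = s j.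
Proof. by rewrite -expr2 sqr_sqrtr // ltW. Qed.

(** Symmetrising the diagonal terms yields the classical Dirichlet form, halved because ordered
    pairs meet each edge twice. The remainder involves off-diagonal entries only. *)
Lemma dirichlet_formE u : dirichlet_form u =
  (\sum_a \sum_b gamma a b * s a * s b * (u a a - u b b) ^+ 2) / 2%:R +
  \sum_a \sum_(b | b != a) Num.sqrt (s a) * Num.sqrt (s b) *
    ((degree e gamma s a + degree e gamma s b) / 2%:R * u a b ^+ 2
      - gamma a b * (Num.sqrt (s a) * Num.sqrt (s b)) * (u a b * u b a)).
Proof.
have degE a : degree e gamma s a = \sum_k gamma a k * s k by apply: degreeE.
pose A := \sum_a \sum_b gamma a b * s a * s b * u a a ^+ 2.
have AE : \sum_a \sum_b gamma a b * s a * s b * u b b ^+ 2 = A.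
  rewrite exchange_big; apply: eq_bigr => a _; apply: eq_bigr => b _ /=.
  by rewrite (gammaC b a); ring.
pose B := \sum_a \sum_b gamma a b * s a * s b * (u a a * u b b).
have -> : \sum_a \sum_b gamma a b * s a * s b * (u a a - u b b) ^+ 2
    = 2%:R * (A - B).
  transitivity (A + \sum_a \sum_b gamma a b * s a * s b * u b b ^+ 2
                - 2%:R * B).
    rewrite /A /B mulr_sumr -!(sumrB, big_split); apply: eq_bigr => a _ /=.
    rewrite mulr_sumr -!(sumrB, big_split); apply: eq_bigr => b _ /=; ring.
  rewrite AE; ring.
rewrite mulrAC divff ?pnatr_eq0 // mul1r -sumrB -big_split.
apply: eq_bigr => a _; rewrite (bigD1 a) //=; congr (_ + _); last first.
  apply: eq_bigr => b /negbTE ba; rewrite /generator_coef eq_sym ba mulr0n.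
  ring.
rewrite /generator_coef eqxx weight_diag sqr degE.
set d := \sum_k _; set T := \sum_k _ * _ * _.
transitivity (s a * u a a * (d * u a a - T)); first by rewrite mulr1n; field.
rewrite mulr_suml -!sumrB mulr_sumr; apply: eq_bigr => b _ /=; ring.
Qed.

Lemma dirichlet_form_diag (f : 'I_n -> R) :
  dirichlet_form (fun a b => if a == b then f a else 0) =
  (\sum_a \sum_b gamma a b * s a * s b * (f a - f b) ^+ 2) / 2%:R.
Proof.
rewrite dirichlet_formE [X in _ + X]big1 ?addr0 => [|a _]; last first.
  rewrite big1 // => b /negbTE ba; rewrite eq_sym ba; ring.
by congr (_ / _); apply: eq_bigr => a _; apply: eq_bigr => b _; rewrite !eqxx.
Qed.

Lemma kms_formE u : kms_form s u u =
  \sum_a s a * u a a ^+ 2 +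
  \sum_a \sum_(b | b != a) Num.sqrt (s a) * Num.sqrt (s b) * u a b ^+ 2.
Proof.
rewrite -big_split; apply: eq_bigr => a _ /=.
by rewrite (bigD1 a) //= sqr expr2.
Qed.

Lemma kms_form_ge0 u : 0 <= kms_form s u u.
Proof.
apply: sumr_ge0 => a _; apply: sumr_ge0 => b _.
by apply: mulr_ge0; [apply: mulr_ge0; apply: sqrtr_ge0|apply: sqr_ge0].
Qed.

Lemma kms_form_gt0 u a b : u a b != 0 -> 0 < kms_form s u u.
Proof.
move=> uab; have term_ge0 i j :
    0 <= Num.sqrt (s i) * Num.sqrt (s j) * (u i j * u i j).
  by apply: mulr_ge0; [apply: mulr_ge0; apply: sqrtr_ge0|apply: sqr_ge0].
rewrite /kms_form (bigD1 a) //= (bigD1 b) //= -addrA ltr_pwDl //.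
  apply: mulr_gt0; last by rewrite -expr2 exprn_even_gt0.
  by apply: mulr_gt0; rewrite sqrtr_gt0.
by rewrite addr_ge0 ?sumr_ge0 // => i _; apply: sumr_ge0.
Qed.

Lemma kms_form0 u : (forall a b, u a b = 0) -> kms_form s u u = 0.
Proof.
by move=> u0; rewrite /kms_form big1 // => a _; rewrite big1 // => b _;
  rewrite !u0 !mulr0.
Qed.

Lemma dirichlet_form0 u : (forall a b, u a b = 0) -> dirichlet_form u = 0.
Proof.
by move=> u0; rewrite /dirichlet_form /kms_form big1 // => a _;
  rewrite big1 // => b _; rewrite !u0 !(mul0r, mulr0).
Qed.

(** * Gap bounds from the diagonal and the off-diagonal blocks *)

Definition poincare (c : R) : Prop :=
  forall f : 'I_n -> R, \sum_a s a * f a = 0 ->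
    c * \sum_a s a * f a ^+ 2
      <= (\sum_a \sum_b gamma a b * s a * s b * (f a - f b) ^+ 2) / 2%:R.

(** Each block has equal diagonal entries and a nonpositive coupling, so its least eigenvalue, the
    right-hand side, belongs to the symmetric vector. *)
Definition offdiag_bound (c : R) : Prop :=
  forall a b, a != b ->
    c <= (degree e gamma s a + degree e gamma s b) / 2%:R
         - gamma a b * (Num.sqrt (s a) * Num.sqrt (s b)).

Lemma dirichlet_form_ge c u : poincare c -> offdiag_bound c ->
  \sum_a s a * u a a = 0 -> c * kms_form s u u <= dirichlet_form u.
Proof.
move=> cp co u0; rewrite dirichlet_formE kms_formE mulrDr; apply: lerD.
  exact: cp.
pose G a b := gamma a b * (Num.sqrt (s a) * Num.sqrt (s b)).
have GC a b : G a b = G b a by rewrite /G gammaC; ring.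
have sq_ge0 a b : 0 <= Num.sqrt (s a) * Num.sqrt (s b).
  by rewrite mulr_ge0 ?sqrtr_ge0.
pose H u := \sum_a \sum_(b | b != a)
  Num.sqrt (s a) * Num.sqrt (s b) * (G a b * u a b ^+ 2).
have HE : \sum_a \sum_(b | b != a)
    Num.sqrt (s a) * Num.sqrt (s b) * (G a b * u b a ^+ 2) = H u.
  under eq_bigr do rewrite big_mkcond.
  rewrite exchange_big; apply: eq_bigr => a _ /=.
  rewrite [RHS]big_mkcond; apply: eq_bigr => b _ /=.
  by rewrite eq_sym GC [X in X * _]mulrC.
pose D := \sum_a \sum_(b | b != a) Num.sqrt (s a) * Num.sqrt (s b) *
  ((degree e gamma s a + degree e gamma s b) / 2%:R * u a b ^+ 2).
(* The block bound is used in the form [c + G a b <= (d_a + d_b) / 2], entry by entry. *)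
apply: (@le_trans _ _ (D - H u)).
  rewrite mulr_sumr -sumrB; apply: ler_sum => a _.
  rewrite mulr_sumr -sumrB; apply: ler_sum => b ba.
  rewrite -mulrBr mulrCA; apply: ler_wpM2l => //.
  rewrite -mulrBl; apply: ler_wpM2r; first exact: sqr_ge0.
  by apply: co; rewrite eq_sym.
(* Averaging [H u] with its transposed form prepares [u a b * u b a <= (u a b ^+ 2 + u b a ^+ 2) /
   2]. *)
have -> : D - H u = D - (H u + \sum_a \sum_(b | b != a)
    Num.sqrt (s a) * Num.sqrt (s b) * (G a b * u b a ^+ 2)) / 2%:R.
  by rewrite HE -mulr2n -[_ *+ 2]mulr_natr mulfK ?pnatr_eq0.
rewrite -big_split mulr_suml -sumrB; apply: ler_sum => a _ /=.
rewrite -big_split mulr_suml -sumrB; apply: ler_sum => b _ /=.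
have G_ge0 : 0 <= G a b by rewrite mulr_ge0 ?weight_ge0.
rewrite -/(G a b).
have := mulr_ge0 (sq_ge0 a b) (mulr_ge0 G_ge0 (sqr_ge0 (u a b - u b a))); lra.
Qed.

(** A vanishing state means that the real and the imaginary parts of the diagonal both have weighted
    mean zero, so [dirichlet_form_ge] applies to each of them. *)
Lemma rayleigh_ge c X : poincare c -> offdiag_bound c ->
    X != 0 -> state s X = 0 ->
  c <= complex.Re (kms_dot s X (generator e gamma s X) / kms_norm s X ^+ 2).
Proof.
move=> cp co X0 sX; rewrite rayleighE.
set u := fun a b => complex.Re _; set v := fun a b => complex.Im _.
have [a [b Xab]] : exists a b, X a b != 0.
  have [/existsP[a /existsP[b Xab]]|no] :=
    boolP [exists a, exists b, X a b != 0].
    by exists a, b.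
  case/negP: X0; apply/eqP/matrixP => a b; rewrite mxE; apply/eqP.
  by apply: contraNT no => Xab; apply/existsP; exists a;
    apply/existsP; exists b.
have norm_gt0 : 0 < kms_form s u u + kms_form s v v.
  have [u0|u0] := eqVneq (u a b) 0; last first.
    by rewrite ltr_pwDl ?kms_form_ge0 // (kms_form_gt0 _ a b).
  rewrite ltr_wpDl ?kms_form_ge0 // (kms_form_gt0 _ a b) //.
  apply: contraNneq Xab => v0.
  rewrite eq_complex -[complex.Re _]/(u a b) -[complex.Im _]/(v a b).
  by rewrite u0 v0 !eqxx.
rewrite ler_pdivlMr // mulrDr; move: sX; rewrite stateE => sX.
apply: lerD; apply: dirichlet_form_ge => //.
  move/(congr1 (@complex.Re R)): sX; rewrite Re_sum; apply: etrans.
  by apply: eq_bigr => j _; rewrite Re_scale.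
move/(congr1 (@complex.Im R)): sX; rewrite Im_sum; apply: etrans.
by apply: eq_bigr => j _; rewrite Im_scale.
Qed.

(** The real array [u] is tested as a complex matrix. The constant [c0] bounds the quotients from
    below, so that their infimum lies below each of them. *)
Lemma kms_gap_le c0 (u : 'I_n -> 'I_n -> R) a b :
    poincare c0 -> offdiag_bound c0 ->
    u a b != 0 -> \sum_j s j * u j j = 0 ->
  kms_gap s (generator e gamma s) <= dirichlet_form u / kms_form s u u.
Proof.
move=> cp co uab u0; apply: ge_inf.
  by exists c0 => _ [X [X0 sX] <-]; apply: rayleigh_ge.
pose X : 'M[R[i]]_n := \matrix_(i, j) (u i j)%:C.
have XE i j : X i j = (u i j)%:C by rewrite mxE.
exists X.
  split.
    apply: contraNneq uab => /matrixP/(_ a b); rewrite XE mxE.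
    by move/(congr1 (@complex.Re R)) => /= ->.
  rewrite stateE; under eq_bigr do rewrite XE -rmorphM.
  by rewrite -rmorph_sum u0.
rewrite rayleighE [dirichlet_form (fun a b => complex.Im _)]dirichlet_form0.
  rewrite [kms_form s (fun a b => complex.Im _) _]kms_form0 ?addr0.
    congr (_ / _); apply: eq_bigr => i _; apply: eq_bigr => j _; last first.
      by rewrite XE.
    rewrite /generator_coef !XE; congr (_ * (_ * (_ - _ * _ - _))).
    by apply: eq_bigr => k _; rewrite XE.
  by move=> i j; rewrite XE.
by move=> i j; rewrite XE.
Qed.

Lemma kms_gap_ge c : (2 <= n)%N -> poincare c -> offdiag_bound c ->
  c <= kms_gap s (generator e gamma s).
Proof.
move=> n_ge2 cp co; apply: lb_le_inf; last first.
  by move=> _ [X [X0 sX] <-]; apply: rayleigh_ge.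
pose i0 : 'I_n := Ordinal (ltnW n_ge2); pose i1 : 'I_n := Ordinal n_ge2.
(* An off-diagonal matrix unit has state zero, so the infimum runs over a nonempty set. *)
pose X : 'M[R[i]]_n := delta_mx i0 i1.
apply: image_nonempty; exists X; split.
  apply/eqP => /matrixP/(_ i0 i1)/eqP; rewrite !mxE !eqxx.
  by rewrite oner_eq0.
rewrite stateE big1 // => j _; rewrite mxE.
case: (altP (j =P i0)) => [->|_] /=; last by rewrite mulr0.
by rewrite mulr0.
Qed.


(** * Conductance and the bounds that it gives *)

Hypothesis n_ge2 : (2 <= n)%N.

Let s_sum : \sum_j s j = 1. Proof. by case: weights_s. Qed.

Lemma sum_weights_gt0 (S : {set 'I_n}) :
  S != finset.set0 -> 0 < \sum_(j in S) s j.
Proof.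
case/set0Pn => j jS; rewrite (bigD1 j) //= ltr_pwDl // sumr_ge0 // => k _.
exact: ltW.
Qed.

Lemma sum_weightsC (S : {set 'I_n}) :
  \sum_(j in S) s j + \sum_(j in ~: S) s j = 1.
Proof.
rewrite -s_sum [RHS](bigID (fun j => j \in S)) /=; congr (_ + _).
by apply: eq_bigl => j; rewrite inE.
Qed.

Let nontrivial (S : {set 'I_n}) : bool :=
  (S != finset.set0) && (S \proper [set: 'I_n]%SET).

Lemma setC_neq0 (S : {set 'I_n}) :
  S \proper [set: 'I_n]%SET -> ~: S != finset.set0.
Proof.
by case/properP => _ [j _ jS]; apply/set0Pn; exists j; rewrite inE.
Qed.

Lemma cut_ge0 (S : {set 'I_n}) :
  0 <= \sum_(j in S) \sum_(k in ~: S) gamma j k * s j * s k.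
Proof.
apply: sumr_ge0 => j _; apply: sumr_ge0 => k _.
by rewrite !mulr_ge0 ?weight_ge0 // ltW.
Qed.

Lemma cut_min_gt0 (S : {set 'I_n}) : nontrivial S ->
  0 < Num.min (\sum_(j in S) s j) (\sum_(j in ~: S) s j).
Proof.
by case/andP => S0 /setC_neq0 SC0; rewrite lt_min !sum_weights_gt0.
Qed.

Lemma cut_ratio_ge0 (S : {set 'I_n}) :
  nontrivial S -> 0 <= cut_ratio gamma s S.
Proof. by move=> /cut_min_gt0/ltW ?; rewrite divr_ge0 ?cut_ge0. Qed.

Lemma le_conductance c :
    (forall S, nontrivial S -> c <= cut_ratio gamma s S) ->
  c <= conductance gamma s.
Proof.
move=> cP; apply: lb_le_inf.
  (* Bounding the [inf] from below needs a nontrivial cut; a singleton is proper since [n >= 2]. *)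
  pose i0 : 'I_n := Ordinal (ltnW n_ge2); pose i1 : 'I_n := Ordinal n_ge2.
  apply: image_nonempty; exists [set i0]%SET; split.
    by apply/set0Pn; exists i0; rewrite inE.
  by apply/properP; split; [apply: finset.subsetT|exists i1; rewrite !inE].
by move=> _ [S [S0 SP] <-]; apply: cP; rewrite /nontrivial S0.
Qed.

Lemma conductance_ge0 : 0 <= conductance gamma s.
Proof. by apply: le_conductance => S; apply: cut_ratio_ge0. Qed.

Lemma conductance_cut (S : {set 'I_n}) : nontrivial S ->
  conductance gamma s * Num.min (\sum_(j in S) s j) (\sum_(j in ~: S) s j)
    <= \sum_(j in S) \sum_(k in ~: S) gamma j k * s j * s k.
Proof.
move=> SP; rewrite -ler_pdivlMr ?cut_min_gt0 //; apply: ge_inf.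
  exists 0 => _ [T [T0 TP] <-]; apply: cut_ratio_ge0.
  by rewrite /nontrivial T0.
by exists S => //; case/andP: SP.
Qed.

Lemma poincare_le c c' : c <= c' -> poincare c' -> poincare c.
Proof.
move=> cc' cP f f0; apply: le_trans (cP f f0); apply: ler_wpM2r => //.
by apply: sumr_ge0 => j _; rewrite mulr_ge0 ?sqr_ge0 // ltW.
Qed.

Lemma poincare0 : poincare 0.
Proof.
move=> f _; rewrite mul0r divr_ge0 // sumr_ge0 // => a _.
by rewrite sumr_ge0 // => b _; rewrite mulr_ge0 ?sqr_ge0 //
  !mulr_ge0 ?weight_ge0 // ltW.
Qed.

(** Cheeger's inequality applies with edge weights [gamma a b * s a * s b], whose row sums are [s a]
    times the degrees. In the edgeless case the term is 0 and the energy is nonnegative. *)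
Lemma poincare_cheeger : poincare (cheeger_term e gamma s).
Proof.
rewrite /cheeger_term; case: ifPn => [/existsP[j0 /existsP[k0 jk]]|_];
  last exact: poincare0.
set h := conductance _ _; set D := degree_max _ _ _.
have degD j : degree e gamma s j <= D by apply: le_bigmax.
have D_gt0 : 0 < D.
  apply: lt_le_trans (degD j0); rewrite /degree (bigD1 k0) //= ltr_pwDl //.
    by rewrite mulr_gt0 //; case: weights_gamma => _ + _; apply.
  by apply: sumr_ge0 => k _; rewrite mulr_ge0 ?weight_ge0 // ltW.
move=> f f0.
have cutP (S : {set 'I_n}) : S != finset.set0 ->
    2%:R * \sum_(a in S) s a <= \sum_a s a ->
    h * \sum_(a in S) s a
      <= \sum_(a in S) \sum_(b in ~: S) gamma a b * s a * s b.
  (* A set with at most half of the total mass 1 is proper, and its own mass is the minimum in the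
     denominator of its cut ratio. *)
  move=> S0 half; have sC := sum_weightsC S; rewrite s_sum in half.
  have SP : nontrivial S.
    rewrite /nontrivial S0 finset.properT; apply: contraTneq half => ->.
    rewrite (eq_bigl xpredT) => [|j]; last by rewrite inE.
    by rewrite s_sum mulr1 -ltNge ltr1n.
  have := conductance_cut S SP; rewrite min_l //; lra.
have := @cheeger_inequality R n s (fun a b => gamma a b * s a * s b) h D.
move=> /(_ _ _ cutP s_gt0 D_gt0 conductance_ge0 _ f f0) chE.
(* The 2 in [h^2 / (2 D)] cancels against the halved double sum, leaving [h^2 N <= D E]. *)
rewrite mulrAC ler_pdivrMr ?mulr_gt0 //.
set E := \sum_a \sum_b _ in chE *.
suff : h ^+ 2 * \sum_a s a * f a ^+ 2 <= D * E by lra.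
apply: chE => [a b|a b|a].
- by rewrite gammaC mulrAC.
- by rewrite !mulr_ge0 ?weight_ge0 // ltW.
rewrite (eq_bigr (fun b => gamma a b * s b * s a)) => [|b _]; last first.
  by rewrite mulrAC.
by rewrite -mulr_suml -(degreeE R n e gamma s) // ler_pM2r.
Qed.

(** The edge between [a] and [b] does not cross the cut around both, and its share of the block
    eigenvalue is a nonnegative square. The rest of the two degrees is the cut weight up to the
    factors [s a] and [s b], which costs [s_max s]; both sides of the cut have mass at least
    [s_min s]. *)
Lemma offdiag_conductance : (3 <= n)%N ->
  offdiag_bound (s_min s / (2%:R * s_max s) * conductance gamma s).
Proof.
move=> n_ge3 a b ab; set h := conductance _ _.
pose S : {set 'I_n} := [set a; b]%SET.
(* This is where [n >= 3] enters: the complement of the cut must contain a vertex. *)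
have [c cS] : exists c, c \notin S.
  apply/existsP; rewrite -negb_forall; apply/negP => /forallP allS.
  have : (n <= #|S|)%N.
    rewrite -[X in (X <= _)%N](card_ord n) -cardsT subset_leq_card //.
    by apply/fintype.subsetP => i _; apply: allS.
  by rewrite cards2 ab leqNgt n_ge3.
have aS : a \in S by rewrite !inE eqxx.
have SP : nontrivial S.
  apply/andP; split; first by apply/set0Pn; exists a.
  by apply/properP; split; [apply: finset.subsetT|exists c => //];
    rewrite finset.in_setT.
have smin j : s_min s <= s j by apply: bigmin_le.
have smax j : s j <= s_max s by apply: le_bigmax.
have smax_gt0 : 0 < s_max s by apply: lt_le_trans (smax a).
pose rest j := \sum_(k in ~: S) gamma j k * s k.
have rest_ge0 j : 0 <= rest j.
  by apply: sumr_ge0 => k _; rewrite mulr_ge0 ?weight_ge0 // ltW.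
have cutE : \sum_(j in S) \sum_(k in ~: S) gamma j k * s j * s k
    = s a * rest a + s b * rest b.
  rewrite /S big_setU1 ?inE // big_set1 -/S !mulr_sumr.
  by congr (_ + _); apply: eq_bigr => k _; ring.
have degE j : degree e gamma s j
    = gamma j a * s a + gamma j b * s b + rest j.
  rewrite degreeE // (bigID (fun k => k \in S)) /= /S big_setU1 ?inE //.
  rewrite big_set1 -/S; congr (_ + _).
  by apply: eq_bigl => k; rewrite finset.in_setC.
have min_ge : s_min s
    <= Num.min (\sum_(j in S) s j) (\sum_(j in ~: S) s j).
  have le_sum (T : {set 'I_n}) j : j \in T -> s_min s <= \sum_(i in T) s i.
    move=> jT; apply: le_trans (smin j) _; rewrite (bigD1 j) //= lerDl.
    by apply: sumr_ge0 => i _; apply: ltW.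
  by rewrite le_min (le_sum _ a) // (le_sum _ c) // inE.
have h_cut : s_min s * h <= s_max s * (rest a + rest b).
  have := conductance_cut S SP; rewrite cutE => cutS.
  have := ler_wpM2l conductance_ge0 min_ge.
  have := ler_wpM2r (rest_ge0 a) (smax a).
  have := ler_wpM2r (rest_ge0 b) (smax b).
  rewrite -/h in cutS *; lra.
apply: (@le_trans _ _ ((rest a + rest b) / 2%:R)).
  rewrite mulrAC ler_pdivrMr ?mulr_gt0 //; lra.
rewrite !degE !weight_diag (gammaC b a).
(* The block eigenvalue equals [gamma_ab / 2 * (sqrt s_a - sqrt s_b)^2 + (rest a + rest b) / 2]. *)
have := mulr_ge0 (weight_ge0 a b) (sqr_ge0 (Num.sqrt (s a) - Num.sqrt (s b))).
rewrite sqrrB !expr2 !sqr; lra.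
Qed.

Lemma offdiag_bound_le c c' : c <= c' -> offdiag_bound c' -> offdiag_bound c.
Proof. by move=> cc' cP a b ab; apply: le_trans cc' (cP a b ab). Qed.

Lemma kms_form_diag (f : 'I_n -> R) :
  let u a b := if a == b then f a else 0 in
  kms_form s u u = \sum_a s a * f a ^+ 2.
Proof.
move=> u; rewrite kms_formE [X in _ + X]big1 ?addr0 => [|a _]; last first.
  by rewrite big1 // => b /negbTE ba; rewrite /u eq_sym ba expr2 !mulr0.
by apply: eq_bigr => a _; rewrite /u eqxx.
Qed.

(* The test function is the centered indicator of [S]. *)
Lemma kms_gap_le_cut_ratio c0 (S : {set 'I_n}) :
    poincare c0 -> offdiag_bound c0 -> nontrivial S ->
  kms_gap s (generator e gamma s) <= 2%:R * cut_ratio gamma s S.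
Proof.
move=> cp co SP; have /andP[S0 Sp] := SP.
pose sg := \sum_(j in S) s j; pose t := \sum_(j in ~: S) s j.
have sgt : sg + t = 1 by apply: sum_weightsC.
have sg_gt0 : 0 < sg by apply: sum_weights_gt0.
have t_gt0 : 0 < t by apply/sum_weights_gt0/setC_neq0.
have sum_ind : \sum_j s j * (j \in S)%:R = sg.
  rewrite /sg [RHS]big_mkcond; apply: eq_bigr => j _.
  by case: (j \in S); rewrite ?mulr1 ?mulr0.
pose f j : R := (j \in S)%:R - sg.
pose u a b := if a == b then f a else 0.
have /set0Pn[a aS] := S0.
have uaa : u a a != 0.
  rewrite /u eqxx /f aS /= mulr1n.
  by have -> : 1 - sg = t by [lra]; rewrite gt_eqF.
have u0 : \sum_j s j * u j j = 0.
  transitivity (\sum_j s j * (j \in S)%:R - sg * \sum_j s j).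
    rewrite mulr_sumr -sumrB; apply: eq_bigr => j _.
    by rewrite /u eqxx /f; ring.
  by rewrite sum_ind s_sum mulr1 subrr.
apply: le_trans (kms_gap_le c0 u a a cp co uaa u0) _.
rewrite dirichlet_form_diag kms_form_diag.
(* This is the variance of the indicator of [S]. *)
have -> : \sum_i s i * f i ^+ 2 = sg * t.
  transitivity (\sum_j s j * (j \in S)%:R * (1 - 2%:R * sg)
                + sg ^+ 2 * \sum_j s j).
    rewrite [_ ^+ 2 * _]mulr_sumr -big_split; apply: eq_bigr => j _ /=.
    by rewrite /f; case: (j \in S); rewrite /= ?mulr1n ?mulr0n; ring.
  rewrite -mulr_suml sum_ind s_sum; have -> : t = 1 - sg by [lra]; ring.
set cut := \sum_(j in S) \sum_(k in ~: S) gamma j k * s j * s k.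
(* The centring cancels in differences, and differences of indicators have equal squares and
   absolute values. *)
have -> : \sum_i \sum_j gamma i j * s i * s j * (f i - f j) ^+ 2
    = 2%:R * cut.
  rewrite /cut -(cut_indicator R n (fun i j => gamma i j * s i * s j)).
    apply: eq_bigr => i _; apply: eq_bigr => j _; congr (_ * _).
    rewrite /f; case: (i \in S); case: (j \in S); rewrite /= ?mulr1n ?mulr0n.
    - by rewrite !subrr normr0 expr0n.
    - by rewrite subr0 normr1; ring.
    - by rewrite [in RHS]sub0r normrN normr1; ring.
    - by rewrite !subrr normr0 expr0n.
  by move=> i j; rewrite gammaC mulrAC.
have cut0 : 0 <= cut := cut_ge0 S.
rewrite /cut_ratio -/cut -/sg -/t [2%:R * cut]mulrC mulfK ?pnatr_eq0 //.
have m_gt0 : 0 < Num.min sg t by rewrite lt_min sg_gt0.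
rewrite mulrCA; apply: ler_wpM2l => //.
(* What remains is [min sg t <= 2 sg t]: the masses sum to 1, so the larger is at least one half. *)
rewrite -[leLHS]mul1r ler_pdivrMr ?mulr_gt0 // mulrAC ler_pdivlMr // mul1r.
clearbody sg t; have -> : t = 1 - sg by [lra].
case: (leP sg (1 - sg)) => sg_half.
  by have : 0 <= sg * (1 - 2%:R * sg) by [apply: mulr_ge0; lra]; lra.
by have : 0 <= (1 - sg) * (2%:R * sg - 1) by [apply: mulr_ge0; lra]; lra.
Qed.

(** * The graph on two vertices *)

Lemma kms_gap_two_points (j k : 'I_n) : n = 2%N -> j != k ->
  kms_gap s (generator e gamma s)
    = gamma j k / 2%:R * (Num.sqrt (s j) - Num.sqrt (s k)) ^+ 2.
Proof.
move=> n2 jk; have jkT : [set: 'I_n]%SET = [set j; k]%SET.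
  apply/esym/eqP; rewrite eqEcard finset.subsetT cardsT card_ord cards2 jk.
  by rewrite n2.
have sum2 (F : 'I_n -> R) : \sum_i F i = F j + F k.
  rewrite (eq_bigl (fun i => i \in [set: 'I_n]%SET)) => [|i];
    last by rewrite inE.
  by rewrite jkT big_setU1 ?inE // big_set1.
have ss1 : s j + s k = 1 by rewrite -sum2.
set g := gamma j k; have g_ge0 : 0 <= g by apply: weight_ge0.
pose r i := Num.sqrt (s i).
have rr i : r i ^+ 2 = s i by rewrite expr2 sqr.
have r_ge0 i : 0 <= r i by apply: sqrtr_ge0.
have degj : degree e gamma s j = g * s k.
  by rewrite degreeE // sum2 weight_diag mul0r add0r.
have degk : degree e gamma s k = g * s j.
  by rewrite degreeE // sum2 weight_diag mul0r addr0 gammaC.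
set c := g / 2%:R * _.
have cE : c = (g * s k + g * s j) / 2%:R - g * (r j * r k).
  by rewrite /c -/(r j) -/(r k) -!rr; field.
have co : offdiag_bound c.
  move=> a b ab; have [[-> ->]|[-> ->]] : (a = j /\ b = k) \/ (a = k /\ b = j).
    have := finset.in_setT a; have := finset.in_setT b; rewrite jkT !inE.
    move=> /orP[]/eqP bE /orP[]/eqP aE; subst a b; rewrite ?eqxx // in ab.
      by right.
    by left.
  - by rewrite degj degk cE.
  - rewrite degj degk cE (gammaC k j) -/g -/(r j) -/(r k).
    by rewrite (mulrC (r k)) (addrC (g * s j)).
have cp : poincare c.
  move=> f; rewrite !sum2 !weight_diag (gammaC k j) -/g => f0.
  (* The variance of a mean-zero function on two points, so the classical gap is [g]. *)
  have -> : s j * f j ^+ 2 + s k * f k ^+ 2 = s j * s k * (f j - f k) ^+ 2.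
    transitivity ((s j + s k) * (s j * f j ^+ 2 + s k * f k ^+ 2)
       - (s j * f j + s k * f k) ^+ 2); last by ring.
    by rewrite ss1 f0; ring.
  (* By [cE] the block eigenvalue is [g / 2 - g * (r j * r k)], hence below the classical gap. *)
  have c_le : c <= g.
    rewrite cE -mulrDr [s k + _]addrC ss1.
    have := mulr_ge0 g_ge0 (mulr_ge0 (r_ge0 j) (r_ge0 k)); lra.
  have t_ge0 : 0 <= s j * s k * (f j - f k) ^+ 2.
    by rewrite mulr_ge0 ?sqr_ge0 // mulr_ge0 // ltW.
  have := ler_wpM2r t_ge0 c_le; lra.
apply/le_anti/andP; split; last exact: kms_gap_ge.
(* The symmetric vector of the only off-diagonal block attains its least eigenvalue [c]. *)
pose u (a b : 'I_n) : R := (a != b)%:R.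
have ujk : u j k != 0 by rewrite /u jk oner_eq0.
have u0 : \sum_i s i * u i i = 0.
  by rewrite big1 // => i _; rewrite /u eqxx mulr0.
apply: le_trans (kms_gap_le c u j k cp co ujk u0) _.
rewrite ler_pdivrMr; last exact: kms_form_gt0 ujk.
rewrite /dirichlet_form /kms_form !sum2 /generator_coef !sum2.
have jkF := negbTE jk; have kjF : (k == j) = false by rewrite eq_sym.
rewrite /u !eqxx jkF kjF /= degj degk.
rewrite -/(r j) -/(r k) (gammaC k j) -/g cE !weight_diag /= !mulr1n !mulr0n.
lra.
Qed.

End RealForm.

Theorem theorem4p3 (R : realType) (n : nat) (e : rel 'I_n)
    (gamma : 'I_n -> 'I_n -> R) (s : 'I_n -> R)
    (n_ge2 : (2 <= n)%N)
    (graph_e : simple_graph e)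
    (weights_gamma : edge_weights e gamma)
    (weights_s : faithful_weights s) :
  ((3 <= n)%N ->
     Num.min (cheeger_term e gamma s)
             (s_min s / (2%:R * s_max s) * conductance gamma s)
       <= kms_gap s (generator e gamma s)
     /\ kms_gap s (generator e gamma s) <= 2%:R * conductance gamma s)
  /\ (n = 2%N ->
      forall j k : 'I_n, j != k ->
        kms_gap s (generator e gamma s)
          = gamma j k / 2%:R * (Num.sqrt (s j) - Num.sqrt (s k)) ^+ 2).
Proof.
split=> [n_ge3|n2 j k jk]; last exact: (kms_gap_two_points R n e).
set c := Num.min _ _.
have cp : poincare R n gamma s c.
  apply: poincare_le (poincare_cheeger R n e gamma s _ _ _) => //.
  by rewrite ge_min lexx.
have co : offdiag_bound R n e gamma s c.
  apply: offdiag_bound_le (offdiag_conductance R n e gamma s _ _ _ _ _) => //.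
  by rewrite ge_min lexx orbT.
split; first exact: (kms_gap_ge R n e).
(* Half the gap is shown to be a lower bound of all cut ratios, hence of their infimum. *)
rewrite mulrC -ler_pdivrMr ?ltr0n //.
apply: le_conductance => // S SP; rewrite ler_pdivrMr ?ltr0n // mulrC.
exact: (kms_gap_le_cut_ratio R n e gamma s _ _ _ c).
Qed.
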